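(* Let $I\subset\mathbb{R}$ be an interval with interior $I^{\circ}$ and let $f:I\to\mathbb{R}$ be a differentiable mapping on $I^{\circ}$ such that $f'\in L[ma,mb]$, where $m\in(0,1]$ and $ma,mb\in I$ with $a<b$. Then for $\theta,\lambda\in[0,1]$ the following equality holds: $$(1-\theta)\bigl(\lambda f(ma)+(1-\lambda)f(mb)\bigr)+\theta f\bigl((1-\lambda)ma+\lambda mb\bigr)-\frac{1}{m(b-a)}\int_{ma}^{mb}f(x)\,dx$$ $$=m(b-a)\left[-\lambda^2\int_0^1(t-\theta)f'\bigl(tma+(1-t)[(1-\lambda)ma+\lambda mb]\bigr)dt+(1-\lambda)^2\int_0^1(t-\theta)f'\bigl(tmb+(1-t)[(1-\lambda)ma+\lambda mb]\bigr)dt\right].$$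
   Context: $L[c,d]$ denotes the integrable functions on $[c,d]$.
   Formalization: The formal statement also assumes f continuous on [ma,mb]; this is automatic if ma, mb lie in the interior of I, but at an endpoint of I the equality can fail without it (I=[0,1], m=1, a=0, b=1, f(0)=1, f=0 elsewhere, θ=0, λ=1/2 gives 1/2 = 0). *)

(* Defs.v *)
From HB Require Import structures.
From mathcomp Require Import all_boot all_order all_algebra.
From mathcomp Require Import all_classical all_reals all_analysis.

(* Main.v *)
(* With A = ma, B = mb and c = (1 - lambda) A + lambda B, both integrals on the right are integrated by parts along the segments from c to A and from c to B, and the two remaining integrals of f add up to the integral of f over [A, B].
   As f' is only Lebesgue integrable, this rests on the fundamental theorem of calculus for everywhere differentiable functions with integrable derivative, proved as follows. Let h >= f' be nonnegative and integrable, and let u >= h be a lower semicontinuous majorant of almost the same integral. Near every point the primitive W of u grows at least as fast as f, up to an arbitrarily small slope, so f(B) - f(A) is at most the integral of h. Truncating f' from below by -n and letting n tend to infinity gives one inequality; applying it to -f gives the other. *)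
From HB Require Import structures.
Require Import Defs.
From mathcomp Require Import all_boot all_order all_algebra.
From mathcomp Require Import all_classical all_reals all_analysis.
From mathcomp Require Import measurable_realfun lra ring.
Set Implicit Arguments.
Unset Strict Implicit.
Unset Printing Implicit Defensive.
Import Order.TTheory GRing.Theory Num.Theory numFieldNormedType.Exports.

Local Open Scope ring_scope.
Local Open Scope classical_set_scope.

(** * Comparing increments from local bounds to the right *)

Lemma within_itv_continuous_dist (R : realType) (f : R -> R) (a b x e : R) :
  {within `[a, b], continuous f} -> a <= x <= b -> 0 < e ->
  \forall y \near x, a <= y <= b -> `|f x - f y| < e.
Proof.
move=> /subspace_continuousP cf xab e0.
have /cvgrPdist_lt /(_ e e0) : f y @[y --> within `[a, b] (nbhs x)] --> f x.
  by apply: cf; rewrite /= in_itv.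
by rewrite near_withinE /= => H; near=> y => yab; apply: (near H y) => //; rewrite /= in_itv.
Unshelve. all: by end_near. Qed.

(** Continuous induction: from an interior point [c], the set of points satisfying the inequality
    contains its supremum, and the local bound would push past any supremum below [b]. The left
    endpoint, where no local bound is given, is reached by a limit. *)
Lemma le_increment (R : realType) (f W : R -> R) (a b : R) : a < b ->
  {within `[a, b], continuous f} ->
  (forall x y, a <= x -> x <= y -> y <= b -> W x <= W y) ->
  (forall x, a < x < b -> \forall y \near x^'+, f y - f x <= W y - W x) ->
  f b - f a <= W b - W a.
Proof.
move=> ab cf ndW loc.
have from_interior c : a < c < b -> f b - f c <= W b - W c.
  move=> /andP[ac cb].
  (* W may jump, but being nondecreasing it keeps this inequality at sup S. *)
  pose S := [set x | c <= x <= b /\ f x - f c <= W x - W c].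
  have Sc : S c by split; [rewrite lexx ltW | rewrite !subrr].
  have supS : has_sup S by split; [exists c | exists b => x [/andP[]]].
  have cs : c <= sup S by apply: ub_le_sup => //; case: supS.
  have sb : sup S <= b by apply: ge_sup; [exists c | move=> x [/andP[]]].
  have sab : a <= sup S <= b by rewrite sb (le_trans (ltW ac)).
  have SsupS : f (sup S) - f c <= W (sup S) - W c.
    rewrite leNgt; apply/negP => lt_s.
    have e0 : 0 < f (sup S) - (W (sup S) - W c + f c) by lra.
    have /nbhs_ballP[d /= d0 dP] := within_itv_continuous_dist cf sab e0.
    have [x Sx dx] := sup_adherent d0 supS.
    have xs : x <= sup S by apply: ub_le_sup => //; case: supS.
    have [/andP[cx xb] fx] := Sx.
    have xab : a <= x <= b by rewrite xb (le_trans (ltW ac)).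
    have ax : a <= x by lra.
    have := dP x; rewrite /ball/= ger0_norm ?subr_ge0//.
    have := ndW x (sup S) ax xs sb.
    rewrite ltr_norml => ? H.
    have /H/(_ xab)/andP[] : sup S - x < d by lra.
    lra.
  move: (sb); rewrite le_eqVlt => /orP[/eqP <-//|sltb].
  have soo : a < sup S < b by rewrite sltb (lt_le_trans ac).
  have := loc _ soo.
  rewrite near_withinE => /nbhs_ballP[d /= d0 dP].
  (* A point beyond [sup S], within the radius of the local bound and not past [b]; its membership
     in [S] is absurd. *)
  pose y := Num.min b (sup S + d / 2).
  have sy : sup S < y by rewrite lt_min sltb/= ltrDl divr_gt0.
  have yd : y <= sup S + d / 2 by rewrite ge_min lexx orbT.
  have yb : y <= b by rewrite ge_min lexx.
  suff Sy : S y by have := ub_le_sup (proj2 supS) Sy; rewrite leNgt sy.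
  split; first by rewrite yb andbT (le_trans cs)// ltW.
  have := dP y; rewrite /ball/= ltr0_norm ?subr_lt0// => H.
  have : f y - f (sup S) <= W y - W (sup S) by apply: H => //; lra.
  lra.
(* Take the supposed gap as the tolerance for continuity of [f] at [a]: an interior [c] close to
   [a], together with [W a <= W c], contradicts [from_interior]. *)
rewrite leNgt; apply/negP => lt_ab.
have e0 : 0 < f b - f a - (W b - W a) by rewrite subr_gt0.
have aab : a <= a <= b by rewrite lexx ltW.
have /nbhs_ballP[d /= d0 dP] := within_itv_continuous_dist cf aab e0.
pose c := Num.min ((a + b) / 2) (a + d / 2).
have ac : a < c by rewrite lt_min; apply/andP; split; lra.
have cd : c <= a + d / 2 by rewrite ge_min lexx orbT.
have cb : c < b by rewrite gt_min; apply/orP; left; lra.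
have cab : a <= c <= b by rewrite !ltW.
have := dP c; rewrite /ball/= ltr0_norm ?subr_lt0//.
rewrite ltr_norml => H.
have /H/(_ cab)/andP[] : - (a - c) < d by lra.
have := ndW a c (lexx a) (ltW ac) (ltW cb).
have : a < c < b by rewrite ac.
move=> /from_interior; lra.
Qed.

(** * Lower semicontinuous majorants *)

(** The sum counts the multiples of [eta] below [v], so it is [v] rounded up to a multiple of [eta]
    and capped at [N%:R * eta]. *)
Lemma staircase_bounds (R : realType) (eta v : R) (N : nat) : 0 < eta -> 0 <= v ->
  Num.min (N%:R * eta) v <= \sum_(n < N) eta * (n%:R * eta < v)%R%:R
    <= Num.min (N%:R * eta) (v + eta).
Proof.
move=> eta0 v0; elim: N => [|N IH].
  rewrite big_ord0 mul0r !min_l//; last by rewrite addr_ge0// ltW.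
  by rewrite lexx.
rewrite big_ord_recr /=; move: IH.
set S := \sum_(i < N) _.
rewrite -(natr1 N) mulrDl mul1r !le_min !ge_min => /andP[H /andP[S1 S2]].
case: (ltP (N%:R * eta) v) H => Nv H /=; rewrite ?mulr1 ?mulr0 ?addr0.
  apply/and3P; split; [apply/orP; left|..]; move: H => /orP[] H; lra.
apply/and3P; split; [apply/orP; right|..]; move: H => /orP[] H; lra.
Qed.

(* Vitali-Caratheodory: u is the sum of the eta 1_{U n}, where U n is an open set slightly larger than the superlevel set {h > n eta}. *)
Lemma lsc_majorant (R : realType) (h : R -> R) (a b e : R) : a <= b -> 0 < e ->
  (forall x, a <= x <= b -> 0 <= h x) ->
  lebesgue_measure.-integrable `[a, b] (EFin \o h) ->
  exists u : R -> \bar R, [/\ measurable_fun setT u,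
    (forall x, (0 <= u x)%E),
    (\int[lebesgue_measure]_(x in `[a, b]) u x <=
      \int[lebesgue_measure]_(x in `[a, b]) (h x)%:E + e%:E)%E &
    forall x, a <= x <= b -> \forall y \near x, ((h x)%:E <= u y)%E].
Proof.
move=> ab e0 h0 ih; set mu := lebesgue_measure; set D := `[a, b].
have mD : measurable D by exact: measurable_itv.
have muD : mu D = (b - a)%:E.
  rewrite /mu lebesgue_measure_itv/= lte_fin; case: ltP => ba.
    by [].
  congr EFin; lra.
have inD x : D x -> a <= x <= b by rewrite /D /= in_itv.
have mh : measurable_fun D h by apply/measurable_EFinP; exact: measurable_int ih.
(* Rounding [h] up to the staircase costs at most [eta * (b - a)], and enlarging the [E n] to open
   sets costs at most [eta] times the sum of the [1 / 2 ^ n.+1], that is [eta]; together [e]. *)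
pose eta := e / (b - a + 1).
have d0 : 0 < b - a + 1 by lra.
have eta0 : 0 < eta by rewrite divr_gt0.
pose E n := D `&` [set x | n%:R * eta < h x].
have mE n : measurable (E n).
  have -> : E n = D `&` h @^-1` `]n%:R * eta, +oo[.
    by apply/seteqP; split => x [Dx] /=; rewrite in_itv/= andbT.
  exact: mh.
have EfinD n : (mu (E n) < +oo)%E.
  apply: (@le_lt_trans _ _ (mu D)); last by rewrite muD ltry.
  apply: le_measure; rewrite ?inE//; [exact: mE|exact: subIsetl].
have /choice[U UP] n : exists U : set R, [/\ open U, E n `<=` U &
    (mu (U `\` E n) < (1 / (2 ^ n.+1)%:R)%:E)%E].
  by apply: lebesgue_regularity_outer => //; rewrite divr_gt0// ltr0n expn_gt0.
have mU n : measurable (U n) by apply: open_measurable; case: (UP n).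
pose v n y : \bar R := (eta * \1_(U n) y)%:E.
have v0 n y : (0 <= v n y)%E by rewrite lee_fin mulr_ge0// ltW.
have mv n : measurable_fun setT (v n).
  by apply/measurable_EFinP; apply: measurable_funM; [exact: measurable_cst|]; exact: measurable_indic (mU n).
exists (fun y => \sum_(n <oo) v n y)%E; split.
- by apply: ge0_emeasurable_sum => *.
- by move=> x; apply: nneseries_ge0.
- rewrite integral_nneseries//; last by move=> n; exact: measurable_funTS (mv n).
  have muE n : (0 <= mu (E n))%E by [].
  apply: (@le_trans _ _ (\sum_(n <oo) (eta%:E * (mu (E n) + (1 / (2 ^ n.+1)%:R)%:E)))%E).
    apply: lee_nneseries => [n _ _|n _]; first by apply: integral_ge0.
    rewrite /v; under eq_integral do rewrite EFinM.
    rewrite ge0_integralZl_EFin//; last 2 first.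
    + by apply/measurable_EFinP; exact: measurable_indic (mU n).
    + exact: ltW.
    rewrite integral_indic//; last exact: mU.
    apply: lee_wpmul2l; first by rewrite lee_fin ltW.
    have [_ EU /ltW UE] := UP n.
    apply: (@le_trans _ _ (mu (E n) + mu (U n `\` E n))%E); last by rewrite leeD2l.
    have mUE : measurable (U n `\` E n) by exact: measurableD.
    rewrite -measureU//; [|exact: mE|exact: setDIK].
    rewrite setDUK//; apply: le_measure; rewrite ?inE.
    + by apply: measurableI; [exact: mU|exact: mD].
    + exact: mU.
    + exact: subIsetl.
  rewrite nneseriesZl; last first.
    by move=> n _; rewrite adde_ge0// lee_fin divr_ge0.
  apply: (@le_trans _ _ (eta%:E * (\sum_(n <oo) mu (E n) + 1%:E))%E).
    apply: lee_wpmul2l; first by rewrite lee_fin ltW.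
    exact: epsilon_trick.
  rewrite ge0_muleDr//; last by apply: nneseries_ge0.
  (* The measures of the layers are reassembled into the integral of the staircase of [h], which is
     at most [h + eta] pointwise. *)
  have -> : (eta%:E * \sum_(n <oo) mu (E n) =
      \int[mu]_(x in D) \sum_(n <oo) (eta * \1_(E n) x)%:E)%E.
    rewrite integral_nneseries//; last 2 first.
    + by move=> n; apply/measurable_EFinP; apply: measurable_funM; [exact: measurable_cst|]; exact: measurable_indic (mE n).
    + by move=> n x _; rewrite lee_fin mulr_ge0// ltW.
    rewrite -nneseriesZl//; apply: eq_eseriesr => n _.
    under eq_integral do rewrite EFinM.
    rewrite ge0_integralZl_EFin//; last 2 first.
    + by apply/measurable_EFinP; exact: measurable_indic (mE n).
    + exact: ltW.
    by rewrite integral_indic ?setIidl//; [exact: subIsetl|exact: mE].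
  apply: (@le_trans _ _ (\int[mu]_(x in D) ((h x)%:E + eta%:E) + (eta * 1)%:E)%E).
    rewrite -EFinM leeD2r//; apply: ge0_le_integral => //.
    + by move=> x _; apply: nneseries_ge0 => n _ _; rewrite lee_fin mulr_ge0// ltW.
    + apply: ge0_emeasurable_sum => // n.
      * by move=> x _ _; rewrite lee_fin mulr_ge0// ltW.
      * by move=> _; apply/measurable_EFinP; apply: measurable_funM; [exact: measurable_cst|]; exact: measurable_indic (mE n).
    + by apply/measurable_EFinP; apply: measurable_funD.
    + move=> x Dx; apply: lime_le.
        by apply: is_cvg_nneseries => n _ _; rewrite lee_fin mulr_ge0// ltW.
      apply: nearW => N; rewrite sumEFin big_mkord -EFinD lee_fin.
      have /andP[_] := staircase_bounds N eta0 (h0 _ (inD _ Dx)).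
      rewrite le_min => /andP[_]; apply: le_trans.
      apply: ler_sum => n _; apply: ler_wpM2l; first exact: ltW.
      rewrite indicE; case: (boolP (x \in E n)) => [/set_mem[_ ->]//|_].
      by rewrite ler0n.
  rewrite integralD//; last first.
    apply/integrableP; split; first exact: measurable_cst.
    by rewrite integral_cst//= -/mu muD -EFinM ltry.
  rewrite [X in (_ + X + _)%E](_ : _ = (eta * (b - a))%:E); last first.
    by transitivity (eta%:E * mu D)%E; [exact: integral_cst|rewrite muD].
  rewrite -addeA leeD2l// -EFinD lee_fin mulr1 -{2}(mulr1 eta) -mulrDr.
  by rewrite /eta divfK// gt_eqF.
- move=> x xab.
  (* No [E n] with [n >= N] contains [x], so the first [N] layers already reach [h x], and only
     finitely many neighbourhoods of [x] have to be intersected. *)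
  have [N hN] : exists N, h x <= N%:R * eta.
    exists (Num.truncn (h x / eta)).+1.
    by rewrite -ler_pdivrMr// ltW// truncnS_gt.
  have near_U n : \forall y \near x, E n x -> U n y.
    have [En|nE] := pselect (E n x); last first.
      by apply: (@nearW _ (nbhs x)) => y /nE.
    have [oU EU _] := UP n.
    apply: (@filterS _ _ (nbhs_filter x) (U n)) => //.
    exact: open_nbhs_nbhs (conj oU (EU _ En)).
  have : \forall y \near x, forall n : 'I_N, E n x -> U n y.
    by apply: (@filter_forall _ _ _ _ (nbhs_filter x)) => n; exact: near_U.
  apply: (@filterS _ _ (nbhs_filter x)) => y Uy.
  apply: (@le_trans _ _ (\sum_(0 <= n < N) v n y)%E); last first.
    by apply: nneseries_lim_ge.
  rewrite sumEFin big_mkord lee_fin.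
  have /andP[H _] := staircase_bounds N eta0 (h0 _ xab).
  move: H; rewrite min_r// => /le_trans; apply.
  apply: ler_sum => n _; apply: ler_wpM2l; first exact: ltW.
  case: ltP => [nh|_]; last by rewrite ler0n.
  rewrite indicE mem_set//; apply: Uy; split => //.
Qed.

(** * The fundamental theorem of calculus for integrable derivatives *)

Lemma is_derive_increment_right (R : realType) (f : R -> R) (x l e : R) :
  is_derive x 1 f l -> 0 < e ->
  \forall y \near x^'+, f y - f x <= (l + e) * (y - x).
Proof.
move=> [df <-] e0; have /cvgrPdist_lt/(_ e e0) := df.
rewrite !near_withinE => /nbhs_ballP[d /= d0 dP].
apply/nbhs_ballP; exists d => //= y; rewrite /ball/= => xyd xy.
have yx0 : 0 < y - x by rewrite subr_gt0.
have := dP (y - x); rewrite /ball/= sub0r normrN distrC => /(_ xyd (lt0r_neq0 yx0)).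
rewrite [(y - x) *: 1]mulr1 subrK distrC ltr_norml => /andP[_].
rewrite ltrBlDl => /ltW; rewrite [_ *: _]mulrC ler_pdivrMr//.
Qed.

Lemma le_increment_integral (R : realType) (f g h : R -> R) (a b : R) : a < b ->
  {within `[a, b], continuous f} ->
  (forall x, a < x < b -> is_derive x 1 f (g x)) ->
  (forall x, a < x < b -> g x <= h x) ->
  (forall x, a <= x <= b -> 0 <= h x) ->
  lebesgue_measure.-integrable `[a, b] (EFin \o h) ->
  ((f b - f a)%:E <= \int[lebesgue_measure]_(x in `[a, b]) (h x)%:E)%E.
Proof.
move=> ab cf dfg gh h0 ih; set mu := lebesgue_measure.
apply/lee_addgt0Pr => e e0.
have e20 : 0 < e / 2 by rewrite divr_gt0.
have [u [mu_u u0 iu uh]] := lsc_majorant (ltW ab) e20 h0 ih.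
pose I x := (\int[mu]_(t in `[a, x]) u t)%E.
have I0 x : (0 <= I x)%E by apply: integral_ge0.
have Ib_fin : (I b < +oo)%E.
  by apply: le_lt_trans iu _; rewrite lte_add_pinfty ?ltry//; exact: integrable_lty.
have I_split x y : a <= x -> x <= y -> I y = (I x + \int[mu]_(t in `]x, y]) u t)%E.
  move=> ax xy; rewrite /I -ge0_integral_setU//=.
  - congr (integral _ _ _); apply/seteqP; split => t /=; rewrite !in_itv/=.
      by move=> /andP[-> ->]; rewrite andbT; apply/orP; rewrite leNgt orNb.
    move=> [/andP[-> tx]|/andP[xt ->]]; first by rewrite (le_trans tx).
    by rewrite (le_trans ax (ltW xt)).
  - exact: measurable_funTS.
  - apply/disj_setPS => t /=; rewrite !in_itv/= => -[/andP[_ tx] /andP[xt _]].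
    by rewrite leNgt xt in tx.
have I_mono x y : a <= x -> x <= y -> (I x <= I y)%E.
  by move=> ax xy; rewrite (I_split x y)// leeDl//; exact: integral_ge0.
have I_fin x : a <= x -> x <= b -> I x \is a fin_num.
  by move=> ax xb; rewrite ge0_fin_numE//; exact: le_lt_trans (I_mono _ _ ax xb) _.
(* One half of [e] went into the majorant [u]; the other half is spread over the interval as the
   extra slope [d], which absorbs the error in the difference quotient of [f]. *)
pose d := e / 2 / (b - a).
have ba0 : 0 < b - a by rewrite subr_gt0.
have d0 : 0 < d by rewrite divr_gt0.
pose W x := fine (I x) + d * (x - a).
have : f b - f a <= W b - W a.
  apply: le_increment => // [x y ax xy yb|x /andP[ax xb]].
    rewrite /W lerD//; last by rewrite ler_pM2l// lerB.
    by apply: fine_le; [apply: I_fin..|apply: I_mono] => //; lra.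
  have xab : a < x < b by rewrite ax.
  have := is_derive_increment_right (dfg _ xab) d0.
  have xab' : a <= x <= b by rewrite !ltW.
  have := uh _ xab'; rewrite !near_withinE.
  move=> /nbhs_ballP[d1 /= d10 H1] /nbhs_ballP[d2 /= d20 H2].
  apply/nbhs_ballP; exists (Num.min d1 (Num.min d2 (b - x))) => /=.
    by rewrite !lt_min d10 d20 subr_gt0.
  move=> y; rewrite /ball/= => yd xy; move: yd.
  rewrite ltr0_norm ?subr_lt0// !lt_min => /and3P[yd1 yd2 yb].
  have := H2 y; rewrite /ball/= ltr0_norm ?subr_lt0// => /(_ yd2 xy) {}H2.
  have {}yb : y <= b by lra.
  apply: (le_trans H2).
  suff : h x * (y - x) <= fine (I y) - fine (I x).
    have := gh _ xab; rewrite /W => ghx.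
    have : g x * (y - x) <= h x * (y - x) by rewrite ler_wpM2r// subr_ge0 ltW.
    lra.
  rewrite -lee_fin EFinB !fineK; [|apply: I_fin; lra|apply: I_fin; lra].
  rewrite (I_split x y) ?(ltW ax) ?(ltW xy)// addeAC subee ?add0e; last first.
    by apply: I_fin; lra.
  (* Since [u] stays above the constant [h x] near [x], integrating over []x, y]] compares the
     growth of [I] with this slope. *)
  have -> : (h x * (y - x))%:E = (\int[mu]_(t in `]x, y]) (h x)%:E)%E.
    rewrite integral_cst//= lebesgue_measure_itv/= lte_fin xy.
    by rewrite EFinM EFinB.
  apply: ge0_le_integral => //.
  - by move=> t _; rewrite lee_fin h0.
  - exact: measurable_funTS.
  - move=> t; rewrite /= in_itv/= => /andP[xt ty]; apply: H1.
    by rewrite /ball/= ltr0_norm ?subr_lt0//; lra.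
rewrite /W subrr mulr0 addr0 /I set_itv1 integral_set1 /= subr0 /d divfK ?gt_eqF//.
rewrite -lee_fin => /le_trans; apply.
rewrite EFinD fineK; last by apply: I_fin => //; exact: ltW.
apply: (le_trans (leeD2r _ iu)).
by rewrite -addeA -EFinD -splitr.
Qed.

Lemma le_increment_integral_derive (R : realType) (f g : R -> R) (a b : R) :
  a < b -> {within `[a, b], continuous f} ->
  (forall x, a < x < b -> is_derive x 1 f (g x)) ->
  lebesgue_measure.-integrable `[a, b] (EFin \o g) ->
  f b - f a <= \int[lebesgue_measure]_(x in `[a, b]) g x.
Proof.
move=> ab cf dfg ig; set mu := lebesgue_measure.
have mD : measurable `[a, b] by exact: measurable_itv.
have mg : measurable_fun `[a, b] g.
  by apply/measurable_EFinP; exact: measurable_int ig.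
pose t n x := Num.max (g x) (- n%:R).
have mt n : measurable_fun `[a, b] (t n).
  by apply: measurable_maxr => //; exact: measurable_cst.
have t_le n x : `|t n x| <= `|g x|.
  have n0 : 0 <= n%:R :> R by exact: ler0n.
  rewrite /t; case: (leP (g x) (- n%:R)) => // gn.
  by rewrite !ler0_norm; lra.
have it n : mu.-integrable `[a, b] (EFin \o t n).
  apply: le_integrable ig => //; first by apply/measurable_EFinP; exact: mt.
  by move=> x _; rewrite /= lee_fin.
have icst (c : R) : mu.-integrable `[a, b] (EFin \o cst c).
  apply: continuous_compact_integrable; first exact: segment_compact.
  by apply: continuous_subspaceT => x; exact: cst_continuous.
have t_ge n : ((f b - f a)%:E <= \int[mu]_(x in `[a, b]) (t n x)%:E)%E.
  (* Adding [n%:R *: id] shifts the truncated derivative up to a nonnegative bound [t n x + n%:R];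
     the surplus [n%:R * (b - a)] then cancels on both sides. *)
  have cF : {within `[a, b], continuous (f + n%:R *: id)}.
    move=> x; apply: continuousD; first exact: cf.
    apply: continuous_subspaceT => {}x; exact: scaler_continuous.
  have dF x : a < x < b -> is_derive x 1 (f + n%:R *: id) (g x + n%:R *: 1).
    by move=> xab; apply: is_deriveD; exact: dfg.
  have := le_increment_integral (h := fun x => t n x + n%:R) ab cF dF.
  have ih : mu.-integrable `[a, b] (EFin \o (fun x => t n x + n%:R)).
    exact: integrableD (it n) (icst n%:R).
  move=> /(_ _ _ ih) H.
  rewrite -(fineK (integrable_fin_num _ (it n)))// lee_fin.
  have H1 : f b - f a + n%:R * (b - a) <= \int[mu]_(x in `[a, b]) (t n x + n%:R).
    rewrite -lee_fin fineK ?(integrable_fin_num _ ih)//.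
    apply: le_trans (H _ _).
    - rewrite lee_fin !fctE /GRing.scale/=; lra.
    - move=> x xab; rewrite [_ *: _]mulr1 lerD2r /t le_max lexx//.
    - by move=> x _; rewrite -lerBlDr sub0r /t le_max lexx orbT.
  move: H1; rewrite RintegralD//; last exact: icst.
  rewrite Rintegral_cst//= lebesgue_measure_itv/= lte_fin ab/=.
  by rewrite lerD2r.
rewrite -lee_fin fineK; last exact: integrable_fin_num.
have ct : (\int[mu]_(x in `[a, b]) (t n x)%:E)%E @[n --> \oo] -->
    (\int[mu]_(x in `[a, b]) (g x)%:E)%E.
  apply: (@dominated_cvg _ _ _ mu _ mD _ _ (fun x => `|g x|%:E)) => //.
  - by move=> n; apply/measurable_EFinP; exact: mt.
  (* At a fixed [x] the truncation is inactive as soon as [n] exceeds the absolute value of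
     [g x]. *)
  - move=> x _; apply: cvg_near_cst.
    exists (Num.truncn `|g x|).+1 => // n /= gn.
    rewrite /t max_l// lerNl.
    have : `|g x| < n%:R by rewrite (lt_le_trans (truncnS_gt _))// ler_nat.
    by rewrite ltr_norml lerNl => /andP[/ltW].
  - exact: integrable_abse ig.
  - by move=> n x _; rewrite /= lee_fin.
by rewrite -(cvg_lim _ ct)//; apply: lime_ge; [apply/cvg_ex; eexists; exact: ct|exact: nearW].
Qed.

Lemma integrable_FTC2 (R : realType) (f g : R -> R) (a b : R) :
  a < b -> {within `[a, b], continuous f} ->
  (forall x, a < x < b -> is_derive x 1 f (g x)) ->
  lebesgue_measure.-integrable `[a, b] (EFin \o g) ->
  \int[lebesgue_measure]_(x in `[a, b]) g x = f b - f a.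
Proof.
move=> ab cf dfg ig; apply/le_anti/andP; split; last first.
  exact: le_increment_integral_derive.
have iNg : lebesgue_measure.-integrable `[a, b] (EFin \o (- g)).
  exact: integrableN ig.
have := @le_increment_integral_derive _ (- f) (- g) _ _ ab.
have -> : \int[lebesgue_measure]_(x in `[a, b]) (- g) x =
    - \int[lebesgue_measure]_(x in `[a, b]) g x.
  rewrite -[RHS]mulN1r -RintegralZl//; apply: eq_Rintegral => x _.
  by rewrite mulN1r.
have /[swap]/[apply]/(_ _ iNg) : {within `[a, b], continuous (- f)}.
  by move=> x; apply: continuousN; exact: cf.
move=> H; have {H} /= : (- f) b - (- f) a <= - \int[lebesgue_measure]_(x in `[a, b]) g x.
  by apply: H => x xab; apply: is_deriveN; exact: dfg.
rewrite !fctE; lra.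
Qed.

(** * Affine change of variables for Lebesgue measure *)

Section affine.
Context (R : realType) (k c : R) (k0 : k != 0).
Let mu := @lebesgue_measure R.
Let phi (t : measurableTypeR R) : measurableTypeR R := k * t + c.

Lemma measurable_affine : measurable_fun [set: measurableTypeR R] phi.
Proof. by apply: measurable_funD; [apply: measurable_funM|]. Qed.

HB.instance Definition _ := isMeasurableFun.Build _ _ _ _ phi measurable_affine.

(** The scaled pushforward agrees with Lebesgue measure on half-open intervals, and uniqueness
    extends this to measurable sets. A negative [k] only swaps the closed and open ends of the
    preimage. *)
Lemma lebesgue_measure_affine (A : set R) : measurable A ->
  (mu A = `|k|%:E * mu (phi @^-1` A))%E.
Proof.
move=> mA.
apply: (@lebesgue_measure_unique _ (mscale (NngNum (normr_ge0 k)) (pushforward mu phi))) mA => //.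
move=> _ [[x y] _ <-].
rewrite [RHS]/(`|k|%:E * mu (phi @^-1` `]x, y]))%E [LHS]/(mu `]x, y]) /mu.
have [k_gt0|k_le0] := ltP 0 k.
  have -> : phi @^-1` `]x, y] = `](x - c) / k, (y - c) / k].
    apply/seteqP; split => t /=; rewrite /phi !in_itv/= ltr_pdivrMr// ler_pdivlMr//;
      by rewrite ltrBlDr lerBrDr mulrC.
  rewrite !lebesgue_measure_itv /= !lte_fin ltr_pM2r ?invr_gt0// ltrD2r.
  case: ifPn => _ /=; last by rewrite mulr0.
  rewrite gtr0_norm//; congr EFin; field.
  exact: lt0r_neq0.
have k_lt0 : k < 0 by rewrite lt_neqAle k0.
have -> : phi @^-1` `]x, y] = `[(y - c) / k, (x - c) / k[.
  apply/seteqP; split => t /=; rewrite /phi !in_itv/= ltr_ndivlMr// ler_ndivrMr//;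
    by rewrite ltrBlDr lerBrDr mulrC andbC.
rewrite !lebesgue_measure_itv /= !lte_fin ltr_nM2r ?invr_lt0// ltrD2r.
case: ifPn => _ /=; last by rewrite mulr0.
rewrite ltr0_norm//; congr EFin; field.
exact: ltr0_neq0.
Qed.

Lemma integrable_affine (D : set R) (g : R -> \bar R) : measurable D ->
  mu.-integrable D g -> mu.-integrable (phi @^-1` D) (g \o phi).
Proof.
move=> mD /integrableP[mg ig].
have mphiD : measurable (phi @^-1` D).
  by rewrite -[X in measurable X]setTI; exact: measurable_affine.
have mgphi : measurable_fun (phi @^-1` D) (g \o phi).
  apply: (measurable_comp mD) => //; first by move=> _ [t Dt <-].
  exact: measurable_funTS measurable_affine.
apply/integrableP; split => //.
have k_gt0 : (0 < `|k|%:E)%E by rewrite lte_fin normr_gt0.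
(* Multiplying by the positive factor [|k|] preserves finiteness and turns the integral over the
   preimage into the integral over [D]. *)
rewrite -(@lte_pmul2l _ `|k|%:E)//.
have -> : (`|k|%:E * \int[mu]_(t in phi @^-1` D) `|(g \o phi) t| =
    \int[mu]_(x in D) `|g x|)%E.
  have mabs : measurable_fun D (fun x => `|g x|%E) by exact: measurableT_comp.
  rewrite -(@ge0_integral_pushforward _ _ _ _ _ _ measurable_affine mu D (fun x => `|g x|%E))//.
  rewrite -[`|k|%R]/((NngNum (normr_ge0 k))%:num)%R -ge0_integral_mscale//.
  apply: eq_measure_integral => B mB _.
  by rewrite [RHS]lebesgue_measure_affine.
by rewrite gt0_muley.
Qed.

End affine.

Lemma is_derive_affine (R : realType) (p q t : R) :
  is_derive t 1 (fun s : R => s * p + (1 - s) * q) (p - q).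
Proof.
have -> : (fun s : R => s * p + (1 - s) * q) = (p - q) *: id + cst q.
  by apply/funext => s; rewrite !fctE /GRing.scale /=; ring.
rewrite -[X in is_derive _ _ _ X]addr0; apply: is_deriveD.
by apply: is_derive_eq; rewrite [_ *: _]mulr1.
Qed.

(** * Integrals along the segment from [q] (at [t = 0]) to [p] (at [t = 1]) *)

Section segment.
Context (R : realType) (f g : R -> R) (a b p q : R).
Context (pab : a <= p <= b) (qab : a <= q <= b).
Context (cf : {within `[a, b], continuous f}).
Context (dfg : forall x, a < x < b -> is_derive x 1 f (g x)).
Context (ig : lebesgue_measure.-integrable `[a, b] (EFin \o g)).
Let phi (t : R) : R := t * p + (1 - t) * q.

Let phi_itv (t : R) : 0 <= t <= 1 -> a <= phi t <= b.
Proof. rewrite /phi; move: pab qab; nra. Qed.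

(** Distinct endpoints keep the interior of the segment away from [a] and [b], where no derivative
    is given. *)
Let phi_itvo (t : R) : p != q -> 0 < t < 1 -> a < phi t < b.
Proof.
rewrite /phi neq_lt; move: pab qab => /andP[? ?] /andP[? ?] /orP[] ? /andP[? ?];
  apply/andP; split; nra.
Qed.

Let integrable_continuous (h : R -> R) : {within `[0, 1], continuous h} ->
  lebesgue_measure.-integrable `[0, 1] (EFin \o h).
Proof. by apply: continuous_compact_integrable; exact: segment_compact. Qed.

Lemma continuous_segment : {within `[0, 1], continuous (f \o phi)}.
Proof.
apply/subspace_continuousP => t; rewrite /= in_itv/= => t01.
apply/cvgrPdist_lt => e e0; rewrite near_withinE.
have cphi : phi s @[s --> t] --> phi t.
  have [dphi _] := is_derive_affine p q t.
    exact/differentiable_continuous/derivable1_diffP.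
have := cphi _ (within_itv_continuous_dist cf (phi_itv t01) e0).
apply: (@filterS _ _ (nbhs_filter t)) => s H; rewrite /= in_itv/= => s01.
by apply: H; exact: phi_itv.
Qed.

Lemma is_derive_segment (t : R) : p != q -> 0 < t < 1 ->
  is_derive t 1 (f \o phi) ((p - q) * g (phi t)).
Proof.
move=> pq t01; rewrite mulrC; apply: is_derive1_comp.
  exact/dfg/phi_itvo.
exact: is_derive_affine.
Qed.

(** The preimage of [[a, b]] under [phi] contains [[0, 1]], so the affine change of variables
    applies; a degenerate segment gives a constant. *)
Lemma integrable_segment : lebesgue_measure.-integrable `[0, 1] (EFin \o (g \o phi)).
Proof.
have [pq|pq] := eqVneq p q.
  have -> : g \o phi = cst (g q).
    by apply/funext => t; rewrite /= /phi pq -mulrDl addrC subrK mul1r.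
  apply: integrable_continuous; apply: continuous_subspaceT => x.
  exact: cst_continuous.
have pq0 : p - q != 0 by rewrite subr_eq0.
have := @integrable_affine R (p - q) q pq0 _ _ (measurable_itv _) ig.
have -> : (fun t : R => (p - q) * t + q) = phi.
  by apply/funext => t; rewrite /phi; ring.
have mphi : measurable_fun [set: R] phi.
  by apply: measurable_funD; apply: measurable_funM => //; exact: measurable_funB.
apply: integrableS; first 2 last.
- by move=> t; rewrite /= !in_itv/= => /phi_itv.
- by rewrite -[X in measurable X]setTI; exact: mphi.
- exact: measurable_itv.
Qed.

(** The fundamental theorem for [f \o phi]. Applied to a primitive, it serves as the substitution
    rule. *)
Lemma Rintegral_segment :
  (p - q) * \int[lebesgue_measure]_(t in `[0, 1]) g (phi t) = f p - f q.
Proof.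
have [pq|pq] := eqVneq p q; first by rewrite pq !subrr mul0r.
rewrite -RintegralZl//; last exact: integrable_segment.
transitivity ((f \o phi) 1 - (f \o phi) 0); last first.
  by rewrite /= /phi !mul1r !mul0r subrr mul0r subr0 addr0 mul1r add0r.
apply: integrable_FTC2; first exact: ltr01.
- exact: continuous_segment.
- by move=> t; exact: is_derive_segment.
- by apply: (integrableZl _ (p - q) integrable_segment).
Qed.

Lemma Rintegral_segment_by_parts (theta : R) :
  (p - q) * \int[lebesgue_measure]_(t in `[0, 1]) ((t - theta) * g (phi t)) =
  (1 - theta) * f p + theta * f q - \int[lebesgue_measure]_(t in `[0, 1]) f (phi t).
Proof.
have ifphi := integrable_continuous continuous_segment.
have cid (x : R) : {for x, continuous (fun t : R => t - theta)}.
  by apply: cvgB; [exact: cvg_id|exact: cvg_cst].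
have cid01 : {within `[0, 1], continuous (fun t : R => t - theta)}.
  exact: continuous_subspaceT.
have igphi : lebesgue_measure.-integrable `[0, 1]
    (EFin \o (fun t => (t - theta) * g (phi t))).
  suff : lebesgue_measure.-integrable `[0, 1]
      ((EFin \o (fun t : R => t - theta)%R) \* (EFin \o (g \o phi)))%E by [].
  (* The first factor is bounded by [1 + |theta|] on [[0, 1]]. *)
  apply: integrableMr; last exact: integrable_segment.
  - exact: measurable_itv.
  - by apply: measurable_funB => //; exact: measurable_cst.
  - exists (1 + `|theta|); split; first by rewrite num_real.
    move=> M HM t; rewrite /= in_itv/= => /andP[t0 t1].
    rewrite (le_trans (ler_normB _ _))// ger0_norm//; lra.
(* For [p = q] the constant path may sit at [a] or [b], so this case is computed directly. *)
have [pq|pq] := eqVneq p q.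
  rewrite pq subrr mul0r.
  have -> : \int[lebesgue_measure]_(t in `[0, 1]) f (phi t) = f q.
    transitivity (\int[lebesgue_measure]_(t in `[0, 1]) f q).
      by apply: eq_Rintegral => t _; rewrite /phi pq -mulrDl addrC subrK mul1r.
    by rewrite Rintegral_cst//= lebesgue_measure_itv/= lte_fin ltr01/= subr0 mulr1.
  ring.
apply/eqP; rewrite eq_sym subr_eq eq_sym; apply/eqP.
have ipq : lebesgue_measure.-integrable `[0, 1]
    (EFin \o (fun t => (p - q) * ((t - theta) * g (phi t)))).
  by apply: (integrableZl _ (p - q) igphi).
rewrite -RintegralZl// -RintegralD//.
(* With both integrals on one side, the integrand is the derivative of this product, and its
   boundary values give the two terms in [f p] and [f q]. *)
pose F := (fun t => t - theta) * (f \o phi).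
transitivity (F 1 - F 0); last first.
  rewrite /F !fctE /= /phi.
  have -> : 1 * p + (1 - 1) * q = p by ring.
  have -> : 0 * p + (1 - 0) * q = q by ring.
  ring.
apply: integrable_FTC2; first exact: ltr01.
- move=> x; apply: continuousM; [exact: cid01|exact: continuous_segment].
- move=> t t01.
  have -> : (p - q) * ((t - theta) * g (phi t)) + f (phi t) =
      (t - theta) *: ((p - q) * g (phi t)) + (f \o phi) t *: (1 - 0).
    by rewrite /GRing.scale/=; ring.
  by apply: is_deriveM; exact: is_derive_segment.
- by apply: (integrableD _ ipq ifphi).
Qed.

End segment.

(** * The identity itself *)

Lemma is_derive_parameterized_integral (R : realType) (f : R -> R) (a b x : R) :
  lebesgue_measure.-integrable `[a, b] (EFin \o f) -> a < x < b ->
  {for x, continuous f} ->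
  is_derive x 1 (fun y => \int[lebesgue_measure]_(t in `[a, y]) f t) (f x).
Proof.
move=> intf /andP[ax xb] cfx.
have [dF <-] := continuous_FTC1_closed xb intf ax cfx.
by rewrite derive1E; exact: derivableP.
Qed.

Theorem lemma1 (R : realType) (I : set R) (f : R -> R) (m a b theta lambda : R)
  (hI : is_interval I)
  (hm0 : 0 < m) (hm1 : m <= 1)
  (hma : I (m * a)) (hmb : I (m * b)) (hab : a < b)
  (hdf : forall x : R, (I°) x -> derivable f x 1)
  (hcf : {within `[m * a, m * b], continuous f})
  (hint : lebesgue_measure.-integrable `[m * a, m * b] (EFin \o f^`()))
  (htheta0 : 0 <= theta) (htheta1 : theta <= 1)
  (hlambda0 : 0 <= lambda) (hlambda1 : lambda <= 1) :
  (1 - theta) * (lambda * f (m * a) + (1 - lambda) * f (m * b))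
    + theta * f ((1 - lambda) * (m * a) + lambda * (m * b))
    - (m * (b - a))^-1 * (\int[lebesgue_measure]_(x in `[m * a, m * b]) f x)
  = m * (b - a) *
    (- (lambda ^+ 2) *
       (\int[lebesgue_measure]_(t in `[0, 1])
          ((t - theta) *
           (f^`())%classic (t * (m * a)
                             + (1 - t) * ((1 - lambda) * (m * a) + lambda * (m * b)))))
     + (1 - lambda) ^+ 2 *
       (\int[lebesgue_measure]_(t in `[0, 1])
          ((t - theta) *
           (f^`())%classic (t * (m * b)
                             + (1 - t) * ((1 - lambda) * (m * a) + lambda * (m * b)))))).
Proof.
have AB : m * a < m * b by rewrite ltr_pM2l.
have BA : m * (b - a) = m * b - m * a by rewrite mulrBr.
rewrite BA; move: hma hmb hcf hint AB.
move: (m * a) (m * b) => A B IA IB cf ig AB {BA}.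
set c := (1 - lambda) * A + lambda * B.
have cAB : A <= c <= B by rewrite /c; apply/andP; split; nra.
have AAB : A <= A <= B by rewrite lexx ltW.
have BAB : A <= B <= B by rewrite lexx ltW.
have AB_int : `]A, B[ `<=` I°.
  rewrite -open_subsetE; last exact: interval_open.
  move=> x /=; rewrite in_itv/= => /andP[Ax xB].
  by apply: (hI _ _ IA IB); rewrite !ltW.
have dF x : A < x < B -> is_derive x 1 f (f^`() x).
  move=> xAB; rewrite derive1E; apply: derivableP; apply: hdf; apply: AB_int.
  by rewrite /= in_itv.
have intf : lebesgue_measure.-integrable `[A, B] (EFin \o f).
  by apply: continuous_compact_integrable => //; exact: segment_compact.
(* This primitive of [f] goes through the segment lemma in [gA] and [gB], giving the integrals of
   [f] along the segments from [c]. *)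
pose G x := \int[lebesgue_measure]_(t in `[A, x]) f t.
have cG : {within `[A, B], continuous G}.
  exact: parameterized_integral_continuous (ltW AB) intf.
have dG x : A < x < B -> is_derive x 1 G (f x).
  move=> xAB; apply: (is_derive_parameterized_integral intf xAB).
  have [dfx _] := dF _ xAB.
  exact/differentiable_continuous/derivable1_diffP.
have GA : G A = 0 by rewrite /G set_itv1 Rintegral_set1.
have hA := Rintegral_segment_by_parts AAB cAB cf dF ig theta.
have hB := Rintegral_segment_by_parts BAB cAB cf dF ig theta.
have gA := Rintegral_segment AAB cAB cG dG intf.
have gB := Rintegral_segment BAB cAB cG dG intf.
rewrite -/(G B) -/c.
move: hA hB gA gB; rewrite GA.
set DA := Rintegral _ _ _; set FA := Rintegral _ _ _.
set DB := Rintegral _ _ _; set FB := Rintegral _ _ _.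
have -> : A - c = - lambda * (B - A) by rewrite /c; ring.
have -> : B - c = (1 - lambda) * (B - A) by rewrite /c; ring.
move=> hA hB gA gB.
(* The integral of [f] splits at [c] into pieces of length [lambda * (B - A)] and
   [(1 - lambda) * (B - A)]. *)
have -> : G B = (B - A) * (lambda * FA + (1 - lambda) * FB).
  have -> : G B = G B - G c + - (0 - G c) by ring.
  by rewrite -gB -gA; ring.
rewrite mulKf ?subr_eq0 ?gt_eqF//.
(* One factor of each square joins [B - A] to form the signed segment length in [hA] or [hB]; the
   other remains as the weight, so nothing is divided by [lambda] or [1 - lambda]. *)
have -> : (B - A) * (- lambda ^+ 2 * DA + (1 - lambda) ^+ 2 * DB) =
    lambda * (- lambda * (B - A) * DA) + (1 - lambda) * ((1 - lambda) * (B - A) * DB).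
  by ring.
by rewrite hA hB; ring.
Qed.
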